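(* Let $\mathbb{K}=\mathbb{R}$ or $\mathbb{C}$. An $8$-dimensional $2$-step nilpotent Lie algebra over $\mathbb{K}$ with characteristic sequence $(2,1,1,1,1,1,1)$ is symplectic if and only if it is isomorphic to $\mathfrak{h}_3\oplus\mathbb{K}^5$.
   Context: $\mathfrak{h}_3$ is the $3$-dimensional Heisenberg algebra (basis $X_1,X_2,X_3$, only nonzero bracket $[X_1,X_2]=X_3$ up to skew-symmetry) and $\mathbb{K}^5$ is the abelian Lie algebra of dimension $5$; $\oplus$ is the direct product of ideals. For a skew-symmetric bilinear form $\theta$ on a Lie algebra, $d\theta(X,Y,Z)=\theta([X,Y],Z)+\theta([Y,Z],X)+\theta([Z,X],Y)$. A Lie algebra of dimension $2p$ is called symplectic if it admits a skew-symmetric bilinear form $\theta$ with $d\theta=0$ and $\theta^p\neq 0$ (nondegenerate). The lower central series is $C^0(\mathfrak{g})=\mathfrak{g}$, $C^j(\mathfrak{g})=[\mathfrak{g},C^{j-1}(\mathfrak{g})]$; $\mathfrak{g}$ is $2$-step nilpotent if $C^2(\mathfrak{g})=0$ and $C^1(\mathfrak{g})\neq 0$. For $X\in\mathfrak{g}$, $X\ne 0$, in a nilpotent Lie algebra, $c(X)$ denotes the decreasing sequence of the sizes of the Jordan blocks of $\mathrm{ad}(X)$; the characteristic sequence of $\mathfrak{g}$ is $c(\mathfrak{g})=\max\{c(X): X\in\mathfrak{g}\setminus C^1(\mathfrak{g})\}$ for the lexicographic order. *)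

(* Defs.v *)
From HB Require Import structures.
From mathcomp Require Import all_boot all_order all_algebra all_fingroup.
From mathcomp Require Import sesquilinear ring.

Set Implicit Arguments.
Unset Strict Implicit.
Unset Printing Implicit Defensive.

Import Order.TTheory GRing.Theory.

Local Open Scope ring_scope.

Reserved Notation "[ 'lie' x , y ]" (at level 0, format "[ 'lie'  x ,  y ]").

(* All Lie algebras below are finite-dimensional. *)
HB.mixin Record Vector_isLieAlgebra (K : fieldType) V of Vector K V := {
  lie_bracket : V -> V -> V;
  lie_bilinear : bilinear_for *:%R *:%R lie_bracket;
  lie_alternating : forall x, lie_bracket x x = 0;
  lie_jacobi : forall x y z,
    lie_bracket x (lie_bracket y z) + lie_bracket y (lie_bracket z x)
      + lie_bracket z (lie_bracket x y) = 0
}.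

#[short(type="lieAlgType")]
HB.structure Definition LieAlgebra (K : fieldType) :=
  { V of Vector K V & Vector_isLieAlgebra K V }.

Notation "[ 'lie' x , y ]" := (lie_bracket x y) : ring_scope.

HB.instance Definition _ (K : fieldType) (g : lieAlgType K) :=
  bilinear_isBilinear.Build K g g g *:%R *:%R (@lie_bracket K g)
    (@lie_bilinear K g).

Section ProductLie.
Variables (K : fieldType) (g h : lieAlgType K).

Definition prod_lie (x y : g * h) : g * h := ([lie x.1, y.1], [lie x.2, y.2]).

Fact prod_lie_bilinear : bilinear_for *:%R *:%R prod_lie.
Proof.
by split=> u a [x1 x2] [y1 y2]; rewrite /prod_lie /=; congr pair;
  rewrite ?linearPl ?linearPr.
Qed.

Fact prod_lie_alternating x : prod_lie x x = 0.
Proof. by rewrite /prod_lie !lie_alternating. Qed.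

Fact prod_lie_jacobi x y z :
  prod_lie x (prod_lie y z) + prod_lie y (prod_lie z x)
    + prod_lie z (prod_lie x y) = 0.
Proof. by congr pair; rewrite /= lie_jacobi. Qed.

HB.instance Definition _ := Vector_isLieAlgebra.Build K (g * h)%type
  prod_lie_bilinear prod_lie_alternating prod_lie_jacobi.

End ProductLie.

Definition abelian_lie (K : fieldType) (n : nat) : Type := 'rV[K]_n.

Section AbelianLie.
Variables (K : fieldType) (n : nat).
Local Notation a := (abelian_lie K n).

HB.instance Definition _ := Vector.copy a 'rV[K]_n.

Definition abelian_bracket (x y : a) : a := 0.

Fact abelian_bilinear : bilinear_for *:%R *:%R abelian_bracket.
Proof. by split=> u c x y; rewrite /= /abelian_bracket scaler0 addr0. Qed.

Fact abelian_alternating x : abelian_bracket x x = 0. Proof. by []. Qed.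

Fact abelian_jacobi x y z :
  abelian_bracket x (abelian_bracket y z)
    + abelian_bracket y (abelian_bracket z x)
    + abelian_bracket z (abelian_bracket x y) = 0.
Proof. by rewrite /abelian_bracket !addr0. Qed.

HB.instance Definition _ := Vector_isLieAlgebra.Build K a
  abelian_bilinear abelian_alternating abelian_jacobi.

End AbelianLie.

(* [X_1, X_2] = X_3, where X_i is the row vector delta_mx 0 (i - 1). *)
Definition heisenberg3 (K : fieldType) : Type := 'rV[K]_3.

Section Heisenberg3.
Variable (K : fieldType).
Local Notation h3 := (heisenberg3 K).

HB.instance Definition _ := Vector.copy h3 'rV[K]_3.

Definition heis_bracket (x y : h3) : h3 :=
  ((x : 'rV[K]_3) 0 0 * (y : 'rV[K]_3) 0 1
     - (x : 'rV[K]_3) 0 1 * (y : 'rV[K]_3) 0 0) *: delta_mx 0 ord_max.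

Fact heis_bilinear : bilinear_for *:%R *:%R heis_bracket.
Proof.
by split=> u c x y; rewrite /= /heis_bracket scalerA -scalerDl !mxE;
  congr (_ *: _); ring.
Qed.

Fact heis_alternating x : heis_bracket x x = 0.
Proof. by rewrite /heis_bracket mulrC subrr scale0r. Qed.

Fact heis_jacobi x y z :
  heis_bracket x (heis_bracket y z) + heis_bracket y (heis_bracket z x)
    + heis_bracket z (heis_bracket x y) = 0.
Proof.
have E u v w : heis_bracket u (heis_bracket v w) = 0.
  by rewrite /heis_bracket !mxE /= !mulr0 subrr scale0r.
by rewrite !E !addr0.
Qed.

HB.instance Definition _ := Vector_isLieAlgebra.Build K h3
  heis_bilinear heis_alternating heis_jacobi.

End Heisenberg3.

Definition lie_isomorphic (K : fieldType) (g h : lieAlgType K) : Prop :=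
  exists f : {linear g -> h},
    bijective f /\ forall x y, f [lie x, y] = [lie f x, f y].

Section LieTheory.
Variables (K : fieldType) (g : lieAlgType K).

(* The span of all [lie u, v] with u in U and v in V, see lie_prodvP. *)
Definition lie_prodv (U V : {vspace g}) : {vspace g} :=
  <<[seq [lie u, v] | u <- vbasis U, v <- vbasis V]>>%VS.

Lemma lie_prodvP (U V W : {vspace g}) :
  reflect {in U & V, forall u v, [lie u, v] \in W} (lie_prodv U V <= W)%VS.
Proof.
apply: (iffP idP) => [sW u v Uu Vv | sW].
  apply: (subvP sW); rewrite (coord_vbasis Uu) (coord_vbasis Vv).
  rewrite linear_sumlz memv_suml // => i _; rewrite linear_sumr memv_suml // => j _.
  rewrite linearZl_LR linearZr_LR !memvZ // memv_span //.
  by apply/allpairsP; exists ((vbasis U)`_i, (vbasis V)`_j);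
    rewrite !mem_nth ?size_tuple.
apply/span_subvP=> _ /allpairsP[[u v] /= [Uu Vv ->]].
by apply: sW; apply: vbasis_mem.
Qed.

Fixpoint lower_central (j : nat) : {vspace g} :=
  if j is j'.+1 then lie_prodv fullv (lower_central j') else fullv.

Definition two_step_nilpotent : Prop :=
  lower_central 2%N = 0%VS /\ lower_central 1%N <> 0%VS.

End LieTheory.

Definition jordan_block (K : fieldType) (a : K) (k : nat) : 'M[K]_k :=
  \matrix_(i, j) (a *+ (i == j) + (i.+1 == j)%:R).

(* s is the decreasing sequence of the sizes of the Jordan blocks of f: f is
   represented by diag(J_(s_0)(lam_0), J_(s_1)(lam_1), ...) in some basis e. *)
Definition jordan_sizes (K : fieldType) (V : vectType K) (f : V -> V)
    (s : seq nat) : Prop :=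
  [/\ sorted geq s, all (ltn 0%N) s &
      exists (lam : 'I_(size s) -> K)
             (e : (\sum_(k < size s) nth 0%N s k).-tuple V),
        let J := \mxdiag_(k < size s) jordan_block (lam k) (nth 0%N s k) in
        basis_of fullv e /\
        forall i, f (tnth e i) = \sum_j J i j *: tnth e j].

(* s = max c(x) over x outside C^1(g), for the lexicographic order; x != 0 is
   automatic. Meaningful for nilpotent g: then every ad x has a Jordan form. *)
Definition characteristic_sequence (K : fieldType) (g : lieAlgType K)
    (s : seq nat) : Prop :=
  (exists2 x : g, x \notin lower_central g 1%N &
     jordan_sizes (lie_bracket x) s) /\
  (forall (x : g) (t : seq nat), x \notin lower_central g 1%N ->
     jordan_sizes (lie_bracket x) t -> (t <= s :> seqlexi nat)%O).

Definition pair_fst (p : nat) (i : 'I_p) : 'I_p.*2 :=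
  Ordinal (etrans (ltn_double i p) (ltn_ord i)).

Definition pair_snd (p : nat) (i : 'I_p) : 'I_p.*2 :=
  Ordinal (etrans (ltn_Sdouble i p) (ltn_ord i)).

Section TwoForms.
Variables (K : fieldType) (g : lieAlgType K).

(* The p-th exterior power of a 2-form, evaluated at x_0, ..., x_(2p-1):
     2^-p sum_s sgn(s) theta(x_s(0), x_s(1)) ... theta(x_s(2p-2), x_s(2p-1)). *)
Definition wedge_power (theta : {biscalar g}) (p : nat) (x : 'I_p.*2 -> g) : K :=
  (2%:R ^+ p)^-1 * \sum_(s : 'S_(p.*2)) (-1) ^+ s *
    \prod_(i < p) theta (x (s (pair_fst i))) (x (s (pair_snd i))).

Definition lie_differential (theta : {biscalar g}) (x y z : g) : K :=
  theta [lie x, y] z + theta [lie y, z] x + theta [lie z, x] y.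

Definition symplectic : Prop :=
  exists p : nat, \dim (fullv : {vspace g}) = p.*2 /\
  exists theta : {biscalar g},
    [/\ forall x y, theta x y = - theta y x,
        forall x y z, lie_differential theta x y z = 0 &
        exists x : 'I_p.*2 -> g, wedge_power theta x <> 0].

End TwoForms.

Arguments symplectic {K} g.
Arguments two_step_nilpotent {K} g.

(* Main.v *)
From HB Require Import structures.
Require Import Defs.
From mathcomp Require Import all_boot all_order all_algebra all_fingroup.
From mathcomp Require Import reals complex.
From mathcomp Require Import sesquilinear ring.

Set Implicit Arguments.
Unset Strict Implicit.
Unset Printing Implicit Defensive.

Import Order.TTheory GRing.Theory Num.Theory.

Local Open Scope ring_scope.

(** The characteristic sequence bounds ranks. In a 2-step nilpotent algebra
    every [ad x] squares to zero, so its Jordan blocks have sizes 2 (as many as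
    its rank) and 1 ([jordan_sizes_square_zero]). A maximal sequence
    (2, 1, ..., 1) therefore says that every [ad x] has rank at most 1
    ([ad_rank_le1]), and a bilinear alternating bracket all of whose partial
    maps have rank at most 1 takes its values in a single line spanned by some
    [z] ([lie_bracket_line]). So the bracket is [omega(x, y) z] for an
    alternating form [omega] of unknown rank, and the point is that a
    symplectic form forces this rank to be 2.

    Let [theta] be symplectic and put [alpha := theta(z, -)]. Closedness of
    [theta] reads [omega /\ alpha = 0], and [alpha] is nonzero because [z] is
    not in the radical of [theta]; hence [omega = alpha /\ beta] is
    decomposable. Since [alpha] and [beta] both vanish at [z], a basis adapted
    to [alpha], [beta] and [z] exhibits the algebra as the direct product of
    the Heisenberg algebra and an abelian one ([lie_isomorphic_heisenberg]).

    For the converse, let [x_1, x_2, x_3] and [y_1, ..., y_5] be the coordinates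
    on the Heisenberg algebra and on the abelian factor. The form
    [x_1 /\ x_3 + x_2 /\ y_1 + y_2 /\ y_3 + y_4 /\ y_5] is symplectic: the
    bracket only interacts with its first term, through [d x_3], which is a
    multiple of [x_1 /\ x_2] and so is killed by [x_1].

    Nondegeneracy is expressed by a nonzero top exterior power, a signed sum
    over permutations. Two facts connect this sum with bilinear algebra. It is
    multiplied by the determinant under a change of vectors
    ([wedge_power_mulmx]), so it vanishes as soon as [theta] has a nonzero
    radical ([wedge_power_radical]). And on a Darboux family each of its terms
    is 0 or 1, because the sign of a permutation preserving the pairing is the
    product of the signs of the flips that it performs on the pairs
    ([odd_paired_perm]); so in characteristic 0 it does not vanish
    ([wedge_power_darboux]). *)

(** * Top exterior powers of a 2-form *)

Lemma big_double_pairs (R : Type) (idx : R) (op : Monoid.com_law idx) p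
    (F : 'I_p.*2 -> R) :
  \big[op/idx]_k F k =
  \big[op/idx]_(i < p) op (F (pair_fst i)) (F (pair_snd i)).
Proof.
elim: p F => [|p IHp] F; first by rewrite !big_ord0.
rewrite big_ord_recr [RHS]big_ord_recr /=.
rewrite (@big_ord_recr _ _ _ p.*2 (fun k => F (widen_ord (leqnSn _) k))) /= IHp.
rewrite Monoid.mulmA; congr (op (op _ (F _)) (F _)); do ?exact: val_inj.
by apply: eq_bigr => i _; congr (op (F _) (F _)); apply: val_inj.
Qed.

(** Expanding every [theta (x_k, x_l)] over the [e_j] turns the sum over
    permutations into a sum over the choices [f] of one index per slot; for a
    fixed choice the signed sum is the determinant of [A] with its columns
    selected by [f], which factors as [\det A] times a number independent of
    [A]. *)
Lemma wedge_power_mulmx (K : fieldType) (g : lieAlgType K)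
    (theta : {biscalar g}) p (A : 'M[K]_p.*2) (e : 'I_p.*2 -> g) :
  wedge_power theta (fun i => \sum_j A i j *: e j) =
  \det A * wedge_power theta e.
Proof.
pose flat (f : {ffun 'I_p -> 'I_p.*2 * 'I_p.*2}) (k : 'I_p.*2) : 'I_p.*2 :=
  let i := Ordinal (etrans (ltn_half_double k p) (ltn_ord k)) in
  if odd k then (f i).2 else (f i).1.
(* [flat f] is the choice of indices [f] read slot by slot, not pair by pair. *)
have flat_fst f i : flat f (pair_fst i) = (f i).1.
  rewrite /flat /= odd_double; congr (f _).1.
  by apply: val_inj; rewrite /= doubleK.
have flat_snd f i : flat f (pair_snd i) = (f i).2.
  rewrite /flat /= odd_double /=; congr (f _).2.
  by apply: val_inj; rewrite /= uphalf_double.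
have expand (B : 'M[K]_p.*2) :
    wedge_power theta (fun i => \sum_j B i j *: e j) =
    \det B * ((2%:R ^+ p)^-1 * \sum_(f : {ffun 'I_p -> 'I_p.*2 * 'I_p.*2})
      \det (rowsub (flat f) 1%:M) * \prod_i theta (e (f i).1) (e (f i).2)).
  rewrite /wedge_power mulrCA; congr (_ * _).
  transitivity (\sum_(s : 'S_p.*2) \sum_(f : {ffun 'I_p -> 'I_p.*2 * 'I_p.*2})
      (-1) ^+ s * (\prod_k B (s k) (flat f k)) *
        \prod_i theta (e (f i).1) (e (f i).2)).
    apply: eq_bigr => s _.
    under eq_bigr => i _.
      rewrite linear_sumlz; under eq_bigr => j _ do rewrite linear_sumr.
      rewrite pair_big /=; over.
    rewrite (bigA_distr_bigA (fun i (jk : 'I_p.*2 * 'I_p.*2) => _)).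
    rewrite mulr_sumr /=.
    apply: eq_bigr => f _; rewrite -mulrA; congr (_ * _).
    rewrite big_double_pairs -big_split; apply: eq_bigr => i _ /=.
    by rewrite flat_fst flat_snd linearZl_LR linearZr_LR mulrA.
  rewrite exchange_big mulr_sumr; apply: eq_bigr => f _ /=.
  rewrite -mulr_suml mulrA; congr (_ * _).
  rewrite [RHS]mulrC -(det_tr B) -det_mulmx mul_rowsub_mx mul1mx.
  by apply: eq_bigr => s _; congr (_ * _); apply: eq_bigr => k _; rewrite !mxE.
rewrite expand; congr (_ * _).
(* The factor that does not depend on the matrix is found by taking A = 1. *)
have := expand 1%:M; rewrite det1 mul1r => <-.
rewrite /wedge_power; congr (_ * _); apply: eq_bigr => s _; congr (_ * _).
have sum1 k : \sum_j (1%:M : 'M[K]_p.*2) k j *: e j = e k.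
  rewrite (bigD1 k) //= mxE eqxx scale1r big1 ?addr0 // => j /negPf njk.
  by rewrite mxE eq_sym njk scale0r.
by apply: eq_bigr => i _; rewrite !sum1.
Qed.

(** In a basis starting with [z], some slot of every term of the sum receives
    [z], so every term vanishes; [wedge_power_mulmx] transfers this to
    arbitrary vectors, which may be linearly dependent. *)
Lemma wedge_power_radical (K : fieldType) (g : lieAlgType K)
    (theta : {biscalar g}) p (x : 'I_p.*2 -> g) (z : g) :
  \dim (fullv : {vspace g}) = p.*2 -> z != 0 ->
  (forall y, theta z y = 0) -> (forall y, theta y z = 0) ->
  wedge_power theta x = 0.
Proof.
move=> dimg z_neq0 thz0 th0z.
have p2_gt0 : (0 < p.*2)%N.
  by rewrite -dimg (leq_trans _ (dimvS (subvf <[z]>))) // dim_vline z_neq0.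
pose X := z :: vbasis (<[z]>^C)%VS.
have sizeX : size X == p.*2.
  by rewrite /= size_tuple dimv_compl dim_vline z_neq0 dimg subn1 prednK.
have basisX : basis_of fullv X.
  rewrite basisEdim span_cons (span_basis (vbasisP _)) addv_complf subvv /=.
  by rewrite dimg -(eqP sizeX).
pose e : p.*2.-tuple g := Tuple sizeX.
pose A := \matrix_(i, j) coord e j (x i).
have -> : wedge_power theta x =
    wedge_power theta (fun i => \sum_j A i j *: e`_j).
  rewrite /wedge_power; congr (_ * _); apply: eq_bigr => s _; congr (_ * _).
  have xE k : x k = \sum_j A k j *: e`_j.
    rewrite {1}(coord_basis (basisX : basis_of _ e) (memvf (x k))).
    by apply: eq_bigr => j _; rewrite mxE.
  by apply: eq_bigr => i _; rewrite -!xE.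
rewrite wedge_power_mulmx /wedge_power big1 ?mulr0 // => s _.
(* [k0] is the slot that receives the basis vector [z] in the term of [s]. *)
pose k0 := (s^-1)%g (Ordinal p2_gt0).
have p_gt0 : (k0./2 < p)%N by rewrite ltn_half_double.
have [k0E|k0E] : k0 = pair_fst (Ordinal p_gt0) \/ k0 = pair_snd (Ordinal p_gt0).
- have := odd_double_half k0; case: odd => /= E; [right|left];
  by apply: val_inj; rewrite /= -{1}E.
- by rewrite (bigD1 (Ordinal p_gt0)) //= -k0E permKV thz0 mul0r mulr0.
- by rewrite (bigD1 (Ordinal p_gt0)) //= -k0E permKV th0z mul0r mulr0.
Qed.

Section DarbouxTuple.
Variable p : nat.

Fact pair_swap_proof (k : 'I_p.*2) : ((if odd k then k.-1 else k.+1) < p.*2)%N.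
Proof.
case: ifP => k_odd; first exact: leq_ltn_trans (leq_pred k) (ltn_ord k).
have := ltn_half_double k p; rewrite ltn_ord -ltn_Sdouble.
by rewrite -[in X in _ -> X](odd_double_half k) k_odd.
Qed.

Definition pair_swap (k : 'I_p.*2) : 'I_p.*2 := Ordinal (pair_swap_proof k).

Lemma odd_pair_swap k : odd (pair_swap k) = ~~ odd k.
Proof. by case: k => -[|k] //= _; case k_odd: (odd k); rewrite /= k_odd. Qed.

Lemma pair_swapK : involutive pair_swap.
Proof.
case=> -[|k] ltk; apply: val_inj => //=.
by case k_odd: (odd k); rewrite /= k_odd.
Qed.

Lemma pair_swap_fst i : pair_swap (pair_fst i) = pair_snd i.
Proof. by apply: val_inj; rewrite /= odd_double. Qed.

Lemma pair_ordP (k : 'I_p.*2) :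
  exists i, k = if odd k then pair_snd i else pair_fst i.
Proof.
exists (Ordinal (etrans (ltn_half_double k p) (ltn_ord k))).
by apply: val_inj; rewrite -[LHS]odd_double_half; case: odd.
Qed.

(** Such a permutation acts in the same way on the first and on the second
    members of the pairs, so it is the product of two conjugate permutations,
    one for each parity. *)
Lemma even_paired_perm (s : 'S_p.*2) :
  (forall k, s (pair_swap k) = pair_swap (s k)) ->
  (forall k, odd (s k) = odd k) -> odd_perm s = false.
Proof.
move=> s_swap odd_s.
pose swap := perm (inv_inj pair_swapK).
(* The first factor acts on the first members only; [swap] conjugates it into
   the second factor. *)
have half_inj : injective (fun k : 'I_p.*2 => if odd k then k else s k).
  move=> k l.
  (case: ifP => odd_k; case: ifP => odd_l) => // [kE|kE|/perm_inj //].
  - by move: odd_k; rewrite kE odd_s odd_l.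
  - by move: odd_k; rewrite -odd_s kE odd_l.
have -> : s = (perm half_inj * (perm half_inj) ^ swap)%g.
  apply/permP=> k; rewrite permM conjgE !permM.
  have swapV l : (swap^-1)%g l = pair_swap l.
    by apply: (@perm_inj _ swap); rewrite permKV permE pair_swapK.
  rewrite swapV (permE _ k); case: ifP => odd_k; rewrite !permE odd_pair_swap.
    by rewrite odd_k /= s_swap pair_swapK.
  by rewrite odd_s odd_k /= pair_swapK.
by rewrite odd_permM odd_permJ addbb.
Qed.

(** The right-hand side is the parity of the number of pairs that [s] maps in
    reverse order. Composing with the transposition of such a pair reverses
    both sides, and once no pair is reversed [even_paired_perm] applies. *)
Lemma odd_paired_perm (s : 'S_p.*2) :
  (forall k, s (pair_swap k) = pair_swap (s k)) ->
  odd_perm s = \big[addb/false]_(i < p) odd (s (pair_fst i)).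
Proof.
have [n] := ubnP #|[pred i | odd (s (pair_fst i))]|.
elim: n s => // n IHn s les s_swap.
have [i0 odd_i0|all_even] := pickP [pred i | odd (s (pair_fst i))]; last first.
  have {}all_even i : odd (s (pair_fst i)) = false := all_even i.
  rewrite big1 => [|i _]; last exact: all_even.
  apply: even_paired_perm => // k; have [i ->] := pair_ordP k.
  case: (odd k); last by rewrite all_even /= odd_double.
  rewrite -pair_swap_fst s_swap !odd_pair_swap all_even /=.
  by rewrite odd_double.
have {}odd_i0 : odd (s (pair_fst i0)) := odd_i0.
pose t := tperm (pair_fst i0) (pair_snd i0).
have t_swap k : t (pair_swap k) = pair_swap (t k).
  rewrite /t (inj_tperm _ _ _ (inv_inj pair_swapK)) -pair_swap_fst pair_swapK.
  by rewrite tpermC.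
have ts_fst i : (t * s)%g (pair_fst i) =
    if i == i0 then pair_swap (s (pair_fst i0)) else s (pair_fst i).
  rewrite permM; case: eqP => [->|i_neq].
    by rewrite tpermL -pair_swap_fst s_swap.
  rewrite tpermD //.
    by apply/eqP => /(congr1 val)/= /double_inj/val_inj/esym.
  by apply/eqP=> /(congr1 (fun k : 'I_p.*2 => odd k)); rewrite /= !odd_double.
have := odd_permM t s; rewrite (IHn (t * s)%g); last 2 first.
- rewrite -ltnS (leq_trans _ les) // ltnS; apply: proper_card.
  apply/properP; split.
    by apply/subsetP=> i; rewrite !inE ts_fst; case: eqP => [->|].
  by exists i0 => //; rewrite inE ts_fst eqxx odd_pair_swap odd_i0.
- by move=> k; rewrite !permM t_swap s_swap.
rewrite odd_tperm -pair_swap_fst.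
have -> : pair_fst i0 != pair_swap (pair_fst i0).
  apply/eqP=> /(congr1 (fun k : 'I_p.*2 => odd k)).
  by rewrite odd_pair_swap; case: odd.
move=> E; apply: (can_inj negbK); rewrite [LHS](esym E).
rewrite (bigD1 i0) // [in RHS](bigD1 i0) //= !ts_fst eqxx odd_pair_swap.
rewrite addNb; congr (~~ (_ (+) _)).
by apply: eq_bigr => i /negPf i_neq; rewrite ts_fst i_neq.
Qed.

(** The term of [s] is 1 if [s] preserves the pairing and 0 otherwise, so the
    sum is the number of such permutations, among which is the identity. *)
Lemma wedge_power_darboux (K : fieldType) (g : lieAlgType K)
    (theta : {biscalar g}) (x : 'I_p.*2 -> g) :
  [pchar K] =i pred0 ->
  (forall k l, theta (x k) (x l) = (-1) ^+ odd k *+ (l == pair_swap k)) ->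
  wedge_power theta x != 0.
Proof.
move=> charK thetaE; have neq0 n : n.+1%:R != 0 :> K.
  by have /pcharf0P-> := charK.
rewrite /wedge_power mulf_neq0 ?invr_neq0 ?expf_neq0 //.
pose paired (s : 'S_p.*2) := [forall k, s (pair_swap k) == pair_swap (s k)].
have termE (s : 'S_p.*2) :
    (-1) ^+ s * \prod_(i < p) theta (x (s (pair_fst i))) (x (s (pair_snd i))) =
    (paired s)%:R.
  have [/forallP/(_ _)/eqP s_swap|s_not] := boolP (paired s).
    have sign0 : (-1) ^+ false = 1 :> K by [].
    rewrite odd_paired_perm // (big_morph _ (signr_addb K) sign0) -big_split.
    rewrite big1 // => i _ /=.
    by rewrite thetaE -pair_swap_fst s_swap eqxx -expr2 sqrr_sign.
  apply/eqP; rewrite mulf_eq0 signr_eq0 /=.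
  apply: contraR s_not => /prodf_neq0 nz.
  have s_fst i : s (pair_snd i) = pair_swap (s (pair_fst i)).
    have := nz i isT; rewrite thetaE mulrb.
    by case: (_ =P pair_swap _) => // _; rewrite eqxx.
  apply/forallP=> k; have [i ->] := pair_ordP k; apply/eqP.
  case: (odd k); last by rewrite pair_swap_fst.
  by rewrite -[in LHS]pair_swap_fst pair_swapK s_fst pair_swapK.
under eq_bigr do rewrite termE.
rewrite -natr_sum (bigD1 1%g) //=.
by have -> : paired 1%g by apply/forallP=> k; rewrite !perm1.
Qed.

End DarbouxTuple.

(** * Jordan bases of square-zero maps *)

Lemma mxdiag_jordan0E (K : fieldType) (s : seq nat)
    (i t : 'I_(\sum_(k < size s) nth 0%N s k)) :
  (\mxdiag_(k < size s) jordan_block (0 : K) (nth 0%N s k)) i t =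
  ((tagnat.sig1 i == tagnat.sig1 t) &&
    ((tagnat.sig2 i).+1 == tagnat.sig2 t :> nat))%:R.
Proof.
rewrite !mxE; move: (tagnat.sig1 i) (tagnat.sig2 i).
move: (tagnat.sig1 t) (tagnat.sig2 t) => k' l' k l.
case: eqVneq l' => [<-|_] l'; last by rewrite mxE.
by rewrite conform_mx_id mxE mul0rn add0r.
Qed.

(** A nilpotent Jordan basis given as a doubly indexed family: [b k 0],
    [b k 1], ... is the chain of the block [k], which [f] shifts to the right
    until it reaches 0. This keeps the arithmetic of block indices out of the
    construction of such bases. The span condition and the bound on the sum of
    [s] together make the family a basis. *)
Lemma jordan_sizes_of_chains (K : fieldType) (V : vectType K) (f : V -> V)
    (s : seq nat) (b : nat -> nat -> V) :
  sorted geq s -> all (ltn 0%N) s -> (sumn s <= \dim (fullv : {vspace V}))%N ->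
  (forall k l, (k < size s)%N -> (l < nth 0%N s k)%N ->
     f (b k l) = if (l.+1 < nth 0%N s k)%N then b k l.+1 else 0) ->
  (forall U : {vspace V}, (forall k l, (k < size s)%N -> (l < nth 0%N s k)%N ->
     b k l \in U) -> (fullv <= U)%VS) ->
  jordan_sizes f s.
Proof.
move=> s_sorted s_gt0 sum_s chain spans; split=> //; exists (fun=> 0).
pose e := [tuple b (tagnat.sig1 i) (tagnat.sig2 i)
            | i < \sum_(k < size s) nth 0%N s k].
have eE k l (ltk : (k < size s)%N) (ltl : (l < nth 0%N s k)%N) :
    tnth e (tagnat.Rank (Ordinal ltk)
             (Ordinal (ltl : l < nth 0 s (Ordinal ltk))%N))
    = b k l.
  by rewrite tnth_mktuple tagnat.Rank2K /= tagnat.Rank1K.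
exists e; split.
  rewrite basisEdim size_tuple; apply/andP; split.
    apply: spans => k l ltk ltl.
    by rewrite -(eE k l ltk ltl) memv_span ?mem_tnth.
  by rewrite -(big_mkord xpredT (nth 0%N s)) -(big_nth 0%N xpredT id) -sumnE.
move=> i; rewrite [RHS](eq_bigr (fun t => ((tagnat.sig1 i == tagnat.sig1 t) &&
    ((tagnat.sig2 i).+1 == tagnat.sig2 t :> nat))%:R *: tnth e t)); last first.
  by move=> t _; rewrite mxdiag_jordan0E.
rewrite tnth_mktuple chain ?ltn_ord //.
case: ifPn => [ltl|last_l]; last first.
  rewrite big1 // => t _.
  case: andP => [[/eqP sig1E /eqP sig2E]|]; last by rewrite scale0r.
  by case/negP: last_l; rewrite sig2E sig1E ltn_ord.
(* Row [i] of the matrix has a single nonzero entry, in the next column [t0]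
   of the same block. *)
pose t0 : 'I_(\sum_(k < size s) nth 0%N s k) :=
  tagnat.Rank (tagnat.sig1 i) (Ordinal ltl).
have sig1_t0 : tagnat.sig1 t0 = tagnat.sig1 i by rewrite tagnat.Rank1K.
have sig2_t0 : tagnat.sig2 t0 = (tagnat.sig2 i).+1 :> nat.
  by rewrite tagnat.Rank2K.
rewrite (bigD1 t0) //= sig2_t0 sig1_t0 !eqxx scale1r.
rewrite tnth_mktuple sig2_t0 sig1_t0.
rewrite big1 ?addr0 // => t.
case: andP => [[/eqP sig1E /eqP sig2E]|_ _]; last by rewrite scale0r.
case/eqP; apply: val_inj; rewrite [LHS]tagnat.rect [RHS]tagnat.rect.
by rewrite sig2_t0 sig1_t0 sig2E sig1E.
Qed.

(** The chains of length 2 are [w_k, u_k] with [u] a basis of the image and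
    [f w_k = u_k]; the chains of length 1 form a basis of a complement [C] of
    the image in the kernel. *)
Lemma jordan_sizes_square_zero (K : fieldType) (V : vectType K)
    (f : {linear V -> V}) :
  (forall v, f (f v) = 0) ->
  let r := \dim (limg (linfun f)) in
  jordan_sizes f (nseq r 2%N ++ nseq (\dim (fullv : {vspace V}) - r.*2) 1%N).
Proof.
move=> ff0 r; set F := linfun f in r *; set m := (_ - _)%N.
pose I := limg F; pose C := (lker F :\: I)%VS.
have sub_ker : (I <= lker F)%VS.
  apply/subvP=> _ /memv_imgP[v _ ->]; by rewrite memv_ker !lfunE /= ff0.
have dimF : (\dim (lker F) + r = \dim (fullv : {vspace V}))%N.
  by rewrite -(limg_ker_dim F fullv) capfv.
have dimC : \dim C = m.
  have := dimv_cap_compl (lker F) I; rewrite (capv_idPr sub_ker) -/r -/C.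
  by rewrite /m -dimF -addnn subnDr => <-; rewrite addKn.
have le_r : (r.*2 <= \dim (fullv : {vspace V}))%N.
  by rewrite -dimF -addnn leq_add2r dimvS.
pose u k := (vbasis I)`_k; pose w k := (F^-1)%VF (u k).
have Fw k : F (w k) = u k.
  have [ltk|gek] := ltnP k r; last first.
    by rewrite /w /u nth_default ?size_tuple // !linear0.
  by apply: limg_lfunVK; rewrite vbasis_mem // mem_nth // size_tuple.
have u_mem k : u k \in I.
  have [ltk|gek] := ltnP k r; last first.
    by rewrite /u nth_default ?size_tuple // mem0v.
  by rewrite vbasis_mem // mem_nth // size_tuple.
pose s := nseq r 2%N ++ nseq m 1%N; rewrite -/s.
have size_s : size s = (r + m)%N by rewrite size_cat !size_nseq.
have nth_s k : (k < size s)%N -> nth 0%N s k = if (k < r)%N then 2 else 1%N.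
  move=> ltk; rewrite nth_cat size_nseq !nth_nseq; have [//|gek] := ltnP k r.
  by rewrite ltn_subLR // -size_s ltk.
pose b k l :=
  if (k < r)%N then if l is 0 then w k else u k else (vbasis C)`_(k - r).
have C_mem k : (vbasis C)`_k \in C.
  have [ltk|gek] := ltnP k (\dim C); last first.
    by rewrite nth_default ?size_tuple // mem0v.
  by rewrite vbasis_mem // mem_nth // size_tuple.
apply: (jordan_sizes_of_chains (b := b)).
- have path1 n : path geq 1%N (nseq n 1%N) by elim: n.
  rewrite /s; case: (r) => [|r']; first by case: (m) => //= m'.
  by elim: r' => //=; case: (m) => //= m'.
- by rewrite all_cat !all_nseq /= !orbT.
- by rewrite sumn_cat !sumn_nseq mul2n mul1n subnKC.
- move=> k l ltk; rewrite nth_s // /b; case: ifP => [ltkr|gekr].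
    case: l => [|[|]] // _ /=; rewrite -[f _](lfunE f) ?Fw //.
    by rewrite -Fw -/F !lfunE /= ff0.
  case: l => // _ /=; apply/eqP; rewrite -[f _](lfunE f) -memv_ker.
  by rewrite (subvP (diffvSl _ _) _ (C_mem _)).
move=> U mem_U.
have I_U : (I <= U)%VS.
  rewrite -(span_basis (vbasisP I)); apply/span_subvP=> v /(nthP 0)[k].
  rewrite size_tuple => ltk <-; have := mem_U k 1%N.
  rewrite size_s nth_s /b ?size_s ltn_addr // ltk.
  by apply.
have C_U : (C <= U)%VS.
  rewrite -(span_basis (vbasisP C)); apply/span_subvP=> v /(nthP 0)[k].
  rewrite size_tuple => ltk <-; rewrite dimC in ltk.
  have := mem_U (r + k)%N 0%N.
  rewrite nth_s /b ?size_s ltn_add2l // (ltnNge (r + k)%N r) leq_addr addKn /=.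
  by apply.
have ker_U : (lker F <= U)%VS.
  by rewrite -(addv_diff_cap (lker F) I) (capv_idPr sub_ker) subv_add C_U.
apply/subvP=> v _.
have /coord_vbasis FvE : F v \in I by rewrite memv_img ?memvf.
pose v' := \sum_(k < r) coord (vbasis I) k (F v) *: w k.
rewrite -(subrK v' v) memvD //.
  rewrite (subvP ker_U) // memv_ker linearB /= {1}FvE linear_sum /= subr_eq0.
  by apply/eqP/eq_bigr => k _; rewrite linearZ /= Fw.
apply: memv_suml => k _; rewrite memvZ //.
have := mem_U k 0%N; rewrite nth_s /b ?size_s ?ltn_addr ?ltn_ord //.
by apply.
Qed.

(** * Brackets with values in a line *)

(** Makes [ad x], seen as a function of its argument, a linear map in the sense
    of [linfun]. *)
Fact lie_bracket_linear (K : fieldType) (g : lieAlgType K) (x : g) :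
  linear (lie_bracket x).
Proof. by move=> a y z; rewrite linearPr. Qed.

HB.instance Definition _ (K : fieldType) (g : lieAlgType K) (x : g) :=
  GRing.isLinear.Build K g g *:%R (lie_bracket x) (lie_bracket_linear x).

Lemma lie_anticomm (K : fieldType) (g : lieAlgType K) (x y : g) :
  [lie x, y] = - [lie y, x].
Proof.
have := lie_alternating (x + y); rewrite linearDr !linearDl /= !lie_alternating.
by rewrite add0r addr0 addrC => /eqP; rewrite addr_eq0 => /eqP.
Qed.

Lemma lie_two_step (K : fieldType) (g : lieAlgType K) (x y z : g) :
  two_step_nilpotent g -> [lie x, [lie y, z]] = 0.
Proof.
case=> C2_0 _; apply/eqP; rewrite -memv0 -C2_0.
have /lie_prodvP C2 := subvv (lower_central g 2); apply: C2; first exact: memvf.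
by have /lie_prodvP C1 := subvv (lower_central g 1); apply: C1; apply: memvf.
Qed.

(** If the rank were at least 2, the Jordan sizes of [ad x] would start with
    (2, 2), which exceeds (2, 1, ..., 1) lexicographically. Such an [x] does
    count for the maximum: the derived algebra is central, so [x] lies outside
    it. *)
Lemma ad_rank_le1 (K : fieldType) (g : lieAlgType K) n (x : g) :
  two_step_nilpotent g -> characteristic_sequence g (2%N :: nseq n 1%N) ->
  (\dim (limg (linfun (lie_bracket x))) <= 1)%N.
Proof.
move=> g2 [_ charmax]; rewrite leqNgt; apply/negP => rank_gt1.
have x_notC1 : x \notin lower_central g 1.
  apply: contraL rank_gt1 => xC1; rewrite -leqNgt.
  suff -> : limg (linfun (lie_bracket x)) = 0%VS by rewrite dimv0.
  apply/eqP; rewrite -subv0; apply/subvP=> _ /memv_imgP[y _ ->].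
  rewrite lfunE /= lie_anticomm memvN -g2.1.
  have /lie_prodvP C2 := subvv (lower_central g 2).
  by apply: C2; rewrite ?memvf.
have ad_sq y : [lie x, [lie x, y]] = 0 by apply: lie_two_step.
have := charmax x _ x_notC1 (jordan_sizes_square_zero ad_sq).
by case: (\dim (limg _)) rank_gt1 => [|[|r]] //= _; case: n {charmax}.
Qed.

(** A space of linear maps of rank at most 1 has either a common image or a
    common kernel hyperplane, and the latter is impossible for an alternating
    bracket. Concretely, with [z = [x0, y0]], all brackets with [x0] or [y0] lie
    on the line of [z]; if [[x, y]] did not, [ad x] would kill [y0], and then
    [ad (x + x0)] would have the two independent values [z] at [y0] and
    [[x + x0, y]] at [y]. *)
Lemma lie_bracket_line (K : fieldType) (g : lieAlgType K) (x0 y0 x y : g) :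
  (forall a : g, \dim (limg (linfun (lie_bracket a))) <= 1)%N ->
  [lie x0, y0] != 0 -> [lie x, y] \in <[ [lie x0, y0] ]>%VS.
Proof.
move=> rank_le1 z_neq0.
have line (a b c : g) : [lie a, b] != 0 -> [lie a, c] \in <[ [lie a, b] ]>%VS.
  move=> ab_neq0; have im d : [lie a, d] \in limg (linfun (lie_bracket a)).
    by rewrite -[[lie a, d]](lfunE (lie_bracket a)) memv_img ?memvf.
  suff -> : <[ [lie a, b] ]>%VS = limg (linfun (lie_bracket a)) by [].
  apply/eqP; rewrite eqEdim -memvE im dim_vline ab_neq0; exact: rank_le1.
set z := [lie x0, y0] in z_neq0 *.
have x0_line (b : g) : [lie x0, b] \in <[z]>%VS by apply: line.
have y0_line (b : g) : [lie b, y0] \in <[z]>%VS.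
  have := line y0 x0 b; rewrite (lie_anticomm y0 x0) oppr_eq0 => /(_ z_neq0).
  case/vlineP=> c y0bE.
  by rewrite (lie_anticomm b) y0bE scalerN opprK memvZ ?memv_line.
have off (a b c : g) : [lie a, b] \notin <[z]>%VS ->
    [lie a, c] \in <[z]>%VS -> [lie a, c] = 0.
  move=> ab_off ac_z; have ab_neq0 : [lie a, b] != 0.
    by apply: contraNneq ab_off => ->; rewrite mem0v.
  have /vlineP[k acE] := line a b c ab_neq0; rewrite acE.
  have [->|k_neq0] := eqVneq k 0; first by rewrite scale0r.
  case/negP: ab_off; rewrite -(scalerK k_neq0 [lie a, b]).
  by rewrite -acE memvZ.
have [//|xy_off] := boolP ([lie x, y] \in <[z]>%VS).
have xy0 : [lie x, y0] = 0 by apply: off xy_off (y0_line x).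
have : [lie x + x0, y0] = 0.
  apply: (off _ y); last exact: y0_line.
  by rewrite linearDl /= (rpredDr _ (x0_line y)).
by rewrite linearDl /= xy0 add0r => z0; rewrite /z z0 eqxx in z_neq0.
Qed.

(** * Recognizing the Heisenberg algebra *)

(** The isomorphism is built backwards, as [G : h_3 + K^n -> g] sending the
    Heisenberg basis to [w], [v], [z] and the abelian one to vectors [k'] of the
    common kernel of [alpha] and [beta]. Reading the first two coordinates of
    [G p] with [alpha] and [beta] gives both injectivity and compatibility with
    the brackets. *)
Lemma lie_isomorphic_heisenberg (K : fieldType) (g : lieAlgType K) n
    (alpha beta : {scalar g}) (w v z : g) :
  \dim (fullv : {vspace g}) = (3 + n)%N -> z != 0 ->
  [/\ alpha w = 1, alpha v = 0 & alpha z = 0] ->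
  [/\ beta w = 0, beta v = 1 & beta z = 0] ->
  (forall x y, [lie x, y] = (alpha x * beta y - beta x * alpha y) *: z) ->
  lie_isomorphic g (heisenberg3 K * abelian_lie K n)%type.
Proof.
move=> dimg z_neq0 [aw av az] [bw bv bz] lieE.
have notin_span (f : {linear g -> K^o}) u (X : seq g) :
    f u = 1 -> all (fun y => f y == 0) X -> u \notin <<X>>%VS.
  move=> fu1 /allP fX0; have sX : (<<X>> <= lker (linfun f))%VS.
    by apply/span_subvP=> y /fX0; rewrite memv_ker lfunE.
  by apply: contraTN isT => /(subvP sX); rewrite memv_ker lfunE /= fu1 oner_eq0.
pose U := <<[:: w; v; z]>>%VS.
have free_wvz : free [:: w; v; z].
  rewrite !free_cons nil_free span_nil memv0 z_neq0 !andbT.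
  rewrite (notin_span alpha) //= ?av ?az ?eqxx //.
  by rewrite (notin_span beta) //= ?bz ?eqxx.
have dimUC : \dim (U^C)%VS = n.
  by rewrite dimv_compl dimg (eqP free_wvz) addKn.
pose k (i : 'I_n) := (vbasis U^C)`_i.
(* Correcting a basis of a complement of [U] by elements of [U] moves it into
   the common kernel while it stays independent modulo [U]. *)
pose k' i := k i - alpha (k i) *: w - beta (k i) *: v.
pose G (p : heisenberg3 K * abelian_lie K n) : g :=
  (p.1 : 'rV_3) 0 0 *: w + (p.1 : 'rV_3) 0 1 *: v + (p.1 : 'rV_3) 0 ord_max *: z
    + \sum_i (p.2 : 'rV_n) 0 i *: k' i.
have G_linear : linear G.
  move=> c [p1 p2] [q1 q2]; rewrite /G /= !mxE !scalerDl !scalerDr !scalerA.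
  have -> : \sum_i (c *: p2 + q2 : 'rV_n) 0 i *: k' i =
      c *: (\sum_i (p2 : 'rV_n) 0 i *: k' i) + \sum_i (q2 : 'rV_n) 0 i *: k' i.
    rewrite scaler_sumr -big_split; apply: eq_bigr => i _.
    by rewrite !mxE scalerDl scalerA.
  by do 3![rewrite [RHS]addrACA; congr (_ + _)].
pose F : {linear (heisenberg3 K * abelian_lie K n)%type -> g} :=
  HB.pack G (GRing.isLinear.Build K _ g *:%R G G_linear).
have alphaG p : alpha (G p) = (p.1 : 'rV_3) 0 0.
  rewrite !linearD linear_sum !linearZ /= aw av az.
  rewrite big1 ?(mulr1, mulr0, addr0) // => i _.
  by rewrite linearZ !linearB !linearZ /= aw av mulr1 mulr0 subr0 subrr mulr0.
have betaG p : beta (G p) = (p.1 : 'rV_3) 0 1.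
  rewrite !linearD linear_sum !linearZ /= bw bv bz.
  rewrite big1 ?(mulr1, mulr0, addr0, add0r) // => i _.
  by rewrite linearZ !linearB !linearZ /= bw bv mulr1 mulr0 subr0 subrr mulr0.
have F_inj : lker (linfun F) == 0%VS.
  rewrite -subv0; apply/subvP=> -[a b].
  rewrite memv_ker lfunE memv0 /= => /eqP G0.
  have a0 : (a : 'rV_3) 0 0 = 0 by rewrite -(alphaG (a, b)) G0 linear0.
  have a1 : (a : 'rV_3) 0 1 = 0 by rewrite -(betaG (a, b)) G0 linear0.
  have kU : \sum_i (b : 'rV_n) 0 i *: k i = 0.
    apply/eqP; rewrite -memv0 -(capv_compl U) memv_cap.
    apply/andP; split; last first.
      apply: memv_suml => i _; rewrite memvZ // vbasis_mem // mem_nth //.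
      by rewrite size_tuple dimUC.
    have U_mem y : y \in [:: w; v; z] -> y \in U by exact: memv_span.
    rewrite -[X in X \in _](subrK (\sum_i (b : 'rV_n) 0 i *: k' i)) memvD //.
      rewrite -sumrB; apply: memv_suml => i _; rewrite -scalerBr memvZ // /k'.
      by rewrite -addrA -opprD subKr memvD ?memvZ ?U_mem ?inE ?eqxx ?orbT.
    move/eqP: G0; rewrite /G /= a0 a1 !scale0r !add0r addrC addr_eq0 => /eqP ->.
    by rewrite memvN memvZ ?U_mem ?inE ?eqxx ?orbT.
  have b0 i : (b : 'rV_n) 0 i = 0.
    have szk : size (vbasis U^C) == n by rewrite size_tuple dimUC.
    have /freeP : free (Tuple szk) by apply: basis_free (vbasisP _).
    by move/(_ (fun j => (b : 'rV_n) 0 j) kU i).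
  have a2 : (a : 'rV_3) 0 ord_max = 0.
    move/eqP: G0; rewrite /G /= a0 a1 !scale0r !add0r.
    rewrite big1 => [|i _]; last by rewrite b0 scale0r.
    by rewrite addr0 scaler_eq0 (negPf z_neq0) orbF => /eqP.
  apply/eqP; congr pair; apply/rowP=> i; rewrite mxE //.
  case: i => -[|[|[|//]]] lti; [rewrite -a0|rewrite -a1|rewrite -a2];
    by congr ((a : 'rV_3) _ _); apply: val_inj.
have limF : limg (linfun F) = fullv.
  apply/eqP; rewrite eqEdim subvf limg_dim_eq ?(eqP F_inj) ?capv0 // dimg dimvf.
  by change (3 + n <= 1 * 3 + 1 * n)%N; rewrite !mul1n.
pose F' : {linear g -> (heisenberg3 K * abelian_lie K n)%type} :=
  (linfun F)^-1%VF.
have FK : cancel G F'.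
  by move=> p; rewrite -[G p](lfunE F); apply: (lker0_lfunK F_inj).
have F'K : cancel F' G.
  by move=> x; rewrite -[G _](lfunE F); apply: limg_lfunVK; rewrite limF memvf.
exists F'; split; first by exists G.
move=> x y; apply: (can_inj FK); rewrite F'K lieE -{1 2}(F'K x) -{1 2}(F'K y).
rewrite !alphaG !betaG; move: (F' x) (F' y) => [a b] [a' b'].
rewrite /G /= !mxE /= !mulr0 !mulr1 !scale0r !add0r big1 ?addr0 // => i _.
by rewrite mxE scale0r.
Qed.

(** With the bracket equal to [omega(x, y) z], [alpha := theta z] and [w] such
    that [alpha w = 1], evaluating [omega /\ alpha = 0] at [(a, b, w)] gives
    [omega = alpha /\ beta] for [beta := omega w]. Characteristic 2 is excluded
    so that the skew-symmetric [theta] is alternating, whence [alpha z = 0];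
    [beta z = 0] holds because [z] is a bracket, hence central. *)
Lemma lie_isomorphic_heisenberg_of_symplectic (K : fieldType)
    (g : lieAlgType K) n :
  2%:R != 0 :> K -> \dim (fullv : {vspace g}) = (3 + n)%N ->
  two_step_nilpotent g ->
  (forall x : g, \dim (limg (linfun (lie_bracket x))) <= 1)%N ->
  symplectic g -> lie_isomorphic g (heisenberg3 K * abelian_lie K n)%type.
Proof.
move=> char2 dimg g2 rank_le1 [p [dimg2p [theta [skew closed [x wedge_neq0]]]]].
have [x0 [y0 z_neq0]] : exists x0 y0 : g, [lie x0, y0] != 0.
  have /allPn[_ /allpairsP[[x0 y0] /= [_ _ ->]] xy_neq0] :
      ~~ all (pred1 0) [seq [lie u, v] | u <- vbasis (fullv : {vspace g}),
                                         v <- vbasis (fullv : {vspace g})].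
    apply/negP=> /allP all0; case: g2 => _; apply; apply/eqP; rewrite -subv0.
    by apply/span_subvP=> u /all0 /eqP ->; rewrite mem0v.
  by exists x0, y0.
set z := [lie x0, y0] in z_neq0.
have skew_diag u : theta u u = 0.
  have /eqP := skew u u; rewrite -subr_eq0 opprK -mulr2n -mulr_natl mulf_eq0.
  by rewrite (negPf char2) => /eqP.
have [w thw] : exists w, theta z w = 1.
  have [/hasP[w1 _ thw1]|/hasPn none] :=
    boolP (has (fun u => theta z u != 0) (vbasis (fullv : {vspace g}))).
    by exists ((theta z w1)^-1 *: w1); rewrite linearZr_LR /= mulVf.
  have thz u : theta z u = 0.
    rewrite (coord_vbasis (memvf u)) linear_sumr big1 // => i _.
    have /negPn/eqP thz0 : ~~ (theta z (vbasis (fullv : {vspace g}))`_i != 0).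
      by apply: none; rewrite mem_nth ?size_tuple.
    by rewrite linearZr_LR /= thz0 mulr0.
  case: wedge_neq0; apply: (wedge_power_radical _ dimg2p z_neq0) => // u.
  by rewrite skew thz oppr0.
pose omega (a b : g) : K := coord [tuple z] ord0 [lie a, b].
have lieE a b : [lie a, b] = omega a b *: z.
  have : [lie a, b] \in <<[tuple z]>>%VS by rewrite span_seq1 lie_bracket_line.
  by move/coord_span=> {1}->; rewrite big_ord1.
have [beta betaE] : exists beta : {scalar g}, forall a, beta a = omega w a.
  have omega_scalar : scalar (omega w) by move=> c a b; rewrite /omega !linearP.
  pose beta : {scalar g} := HB.pack (omega w)
    (GRing.isLinear.Build K g K *%R (omega w) omega_scalar).
  by exists beta.
have ww : beta w = 0 by rewrite betaE /omega lie_alternating linear0.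
have dec a b : [lie a, b] = (theta z a * beta b - beta a * theta z b) *: z.
  rewrite [LHS]lieE; congr (_ *: _).
  have := closed a b w; rewrite /lie_differential [[lie a, b]]lieE.
  rewrite (lie_anticomm b) [[lie w, b]]lieE [[lie w, a]]lieE.
  rewrite linearNl /= !linearZl_LR /= thw mulr1 -!betaE.
  move/eqP; rewrite -addrA addr_eq0 => /eqP ->.
  by rewrite opprD opprK [beta b * _]mulrC.
have [v1 bv1] : exists v1, beta v1 = 1.
  have [v2 bv2] : exists v2, beta v2 != 0.
    have [bx0|] := eqVneq (beta x0) 0; last by exists x0.
    exists y0; apply: contraNneq z_neq0 => by0.
    by rewrite /z dec bx0 by0 mulr0 mul0r subrr scale0r.
  by exists ((beta v2)^-1 *: v2); rewrite linearZ /= mulVf.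
pose v := v1 - theta z v1 *: w.
apply: (@lie_isomorphic_heisenberg _ _ n (theta z) beta w v z) => //.
- split=> //; last exact: skew_diag.
  by rewrite /v /= linearBr linearZr_LR /= thw mulr1 subrr.
- split=> //; first by rewrite /v linearB linearZ /= ww mulr0 subr0.
  by rewrite betaE /omega lie_two_step // linear0.
Qed.

(** * A symplectic form on the Heisenberg product *)

Lemma symplectic_isomorphic (K : fieldType) (g h : lieAlgType K) :
  lie_isomorphic g h -> symplectic h -> symplectic g.
Proof.
case=> f [[f' fK f'K] fM] [p [dimh [theta [theta_skew theta_closed [x thx]]]]].
exists p; split.
  have f_inj : lker (linfun f) = 0%VS.
    by apply/eqP/lker0P => u v; rewrite !lfunE => /(can_inj fK).
  rewrite -(limg_dim_eq (f := linfun f)) ?f_inj ?capv0 // -dimh; congr (\dim _).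
  by apply/vspaceP=> y; rewrite memvf -[y]f'K -[f _](lfunE f) memv_img ?memvf.
pose pullback (u v : g) := theta (f u) (f v).
have pullback_bilinear : bilinear_for *%R *%R pullback.
  by split=> u a v w; rewrite /pullback linearP ?linearPl ?linearPr.
pose theta_g : {biscalar g} := HB.pack pullback
  (bilinear_isBilinear.Build K g g K *%R *%R pullback pullback_bilinear).
exists theta_g; split.
- by move=> u v; apply: theta_skew.
- move=> u v w; rewrite /lie_differential /= /pullback !fM.
  exact: theta_closed.
exists (f' \o x).
suff -> : wedge_power theta_g (f' \o x) = wedge_power theta x by [].
rewrite /wedge_power; congr (_ * _); apply: eq_bigr => s _; congr (_ * _).
by apply: eq_bigr => i _; rewrite /= /pullback /= !f'K.
Qed.

Section HeisenbergForm.

Variable K : fieldType.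
Local Notation h := (heisenberg3 K * abelian_lie K 5)%type.

(** The form [x_1 /\ x_3 + x_2 /\ y_1 + y_2 /\ y_3 + y_4 /\ y_5], in the
    coordinates [x] of the Heisenberg algebra and [y] of the abelian factor,
    numbered from 1. *)
Definition heis_form (p q : h) : K :=
  let a : 'rV[K]_3 := p.1 in let b : 'rV[K]_5 := p.2 in
  let c : 'rV[K]_3 := q.1 in let d : 'rV[K]_5 := q.2 in
  (a 0 0 * c 0 ord_max - a 0 ord_max * c 0 0) + (a 0 1 * d 0 0 - b 0 0 * c 0 1)
  + (b 0 1 * d 0 2 - b 0 2 * d 0 1) + (b 0 3 * d 0 4 - b 0 4 * d 0 3).

Fact heis_form_bilinear : bilinear_for *%R *%R heis_form.
Proof.
by split=> u c [a b] [a' b']; rewrite /heis_form /= !mxE; ring.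
Qed.

HB.instance Definition _ := 
  bilinear_isBilinear.Build K h h K *%R *%R heis_form heis_form_bilinear.

Lemma symplectic_heisenberg : [pchar K] =i pred0 -> symplectic h.
Proof.
move=> charK; exists 4%N; split.
  by rewrite dimvf.
exists heis_form; split.
- by move=> [a b] [a' b']; rewrite /= /heis_form /=; ring.
- move=> [a b] [a' b'] [a'' b''].
  by rewrite /lie_differential /= /heis_form /= !mxE /=; ring.
pose X i : h := (delta_mx 0 i : 'rV_3, 0 : 'rV_5).
pose Y i : h := (0 : 'rV_3, delta_mx 0 i : 'rV_5).
(* The pairs of a Darboux family are adjacent: (X_1, X_3), (X_2, Y_1), ...
   with [X] and [Y] the bases dual to the coordinates of [heis_form]. *)
exists (fun k => nth 0 [:: X 0; X ord_max; X 1; Y 0; Y 1; Y 2; Y 3; Y 4] k).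
apply/eqP; apply: wedge_power_darboux => // k l.
case: k => -[|[|[|[|[|[|[|[|//]]]]]]]] ltk;
case: l => -[|[|[|[|[|[|[|[|//]]]]]]]] ltl;
by rewrite -(inj_eq val_inj) /= /heis_form /= !mxE /=; ring.
Qed.

End HeisenbergForm.

(** * The classification *)

Theorem theorem23 (R : realType) (K : fieldType)
    (hK : K = R :> fieldType \/ K = R[i] :> fieldType)
    (g : lieAlgType K)
    (hdim : \dim (fullv : {vspace g}) = 8%N)
    (h2step : two_step_nilpotent g)
    (hchar : characteristic_sequence g [:: 2; 1; 1; 1; 1; 1; 1]%N) :
  symplectic g <-> lie_isomorphic g (heisenberg3 K * abelian_lie K 5)%type.
Proof.
have charK : [pchar K] =i pred0.
  by case: hK => ->; apply: pchar_num.
split=> [|iso]; last first.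
  exact: symplectic_isomorphic iso (symplectic_heisenberg charK).
apply: lie_isomorphic_heisenberg_of_symplectic => // [|x].
  by have /pcharf0P -> := charK.
exact: (@ad_rank_le1 _ _ 6).
Qed.
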